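(* Let $h:X\to Y$ be a weak homeomorphism between topological spaces. The space $X$ is hereditarily Baire if and only if $Y$ is hereditarily Baire.
   Context: A map $f:X\to Y$ between topological spaces (not necessarily continuous) is weakly discontinuous if each subspace $A\subset X$ contains a relatively open dense subset $U\subset A$ such that the restriction $f|U$ is continuous. A weak homeomorphism is a bijective map $f$ such that both $f$ and $f^{-1}$ are weakly discontinuous. A space $X$ is Baire if the intersection of any countable family of open dense subsets of $X$ is dense in $X$; $X$ is hereditarily Baire if each closed subspace of $X$ is Baire. *)

(* Defs.v *)
From HB Require Import structures.
From mathcomp Require Import all_boot all_order all_algebra.
From mathcomp Require Import all_classical all_reals all_analysis.

Set Implicit Arguments.
Unset Strict Implicit.
Unset Printing Implicit Defensive.

Local Open Scope classical_set_scope.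

(* A set [A : set X] is coerced to the type [set_type A], which carries the
   subspace topology (initial topology of the inclusion, possibly empty), so
   for [U : set A], [open U] and [dense U] mean relatively open and dense in A.
   [sigL A f : A -> Y] is the restriction of [f] to [A]. *)
Definition weakly_discontinuous (X Y : topologicalType) (f : X -> Y) : Prop :=
  forall A : set X, exists U : set A,
    [/\ open U, dense U & {within U, continuous (sigL A f)}].

Definition weak_homeomorphism (X Y : topologicalType) (h : X -> Y) : Prop :=
  exists g : Y -> X,
    [/\ cancel h g, cancel g h, weakly_discontinuous h
      & weakly_discontinuous g].

Definition baire_space (X : topologicalType) : Prop :=
  forall F : set (set X), countable F ->
    (forall U, F U -> open U /\ dense U) ->
    dense (\bigcap_(U in F) U).

Definition hereditarily_baire (X : topologicalType) : Prop :=
  forall A : set X, closed A -> baire_space (set_type A).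

(* Main.v *)
Require Import Defs.
From mathcomp Require Import all_boot all_order all_algebra.
From mathcomp Require Import all_classical all_reals all_analysis.

(** The two implications are symmetric, so suppose that [X] is hereditarily
    Baire and let [A] be closed in [Y].  It suffices to find, inside every
    nonempty relatively open part [B] of [A], a nonempty relatively open set
    which is homeomorphic to an open subset of a closed subspace of [X].

    Weak discontinuity of [g] (the inverse of [h]) on [B] gives a nonempty
    relatively open [V] in [B] on which [g] is continuous.  Put
    [Z := g @` V].  Weak discontinuity of [h], applied not to [Z] but to its
    closure [C], gives a relatively open dense [S] in [C] on which [h] is
    continuous.  The preimage of the closed set [A] is closed in [S] and
    contains the dense subset [S `&` Z], so [h] maps all of [S] into [A];
    hence [S `&` Z], the set of points of [S] mapped into the open set that
    cuts [V] out of [A], is open in [S] and thus in [C].  It is also dense in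
    [C], and [h] is a homeomorphism from it onto an open subset of [A].

    Consequently dense open subsets of [A] pull back, within [S `&` Z], to
    dense open subsets of [C] ([pullback_open_dense]); as [C] is Baire, a
    countable family of these has a common point, and its image under [h] is
    the point sought in [B]. *)

Set Implicit Arguments.
Unset Strict Implicit.
Unset Printing Implicit Defensive.

Local Open Scope classical_set_scope.

Lemma open_set_typeP (X : topologicalType) (A : set X) (U : set A) :
  open U <-> exists2 O : set X, open O & U = val @^-1` O.
Proof. by split=> -[P oP UP]; exists P. Qed.

(** Relatively open sets are represented by open sets of the ambient space,
    since the main argument compares sets that are open in different
    subspaces. *)
Lemma weakly_discontinuous_ambient (X Y : topologicalType) (f : X -> Y) :
  weakly_discontinuous f -> forall A : set X, exists O : set X,
    [/\ open O,
        forall T, open T -> A `&` T !=set0 -> A `&` T `&` O !=set0 &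
        forall V, open V ->
          exists2 G : set X, open G & A `&` O `&` f @^-1` V = A `&` G].
Proof.
move=> wf A; have [U [oU dU cU]] := wf A.
have [ O oO UO] := (open_set_typeP U).1 oU.
exists O; split=> // [T oT [x [Ax Tx]]|V oV].
  have [] := dU (val @^-1` T).
  - by exists (exist _ x (mem_set Ax)).
  - by apply/open_set_typeP; exists T.
  - move=> a [Ta Ua]; exists (val a); split; last by rewrite UO in Ua.
    by split=> //; apply: set_valP.
have /open_subspaceP[W oW WV] := (continuousP _).1 cU V oV.
have [G oG WG] := (open_set_typeP (W `&` U)).1 (openI oW oU).
exists G => //; rewrite eqEsubset; split=> x.
  move=> [[Ax Ox] Vx]; split => //.
  have : (W `&` U) (exist _ x (mem_set Ax)).
    by rewrite WV; split => //; rewrite UO.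
  by rewrite WG.
move=> [Ax Gx].
have : (W `&` U) (exist _ x (mem_set Ax)) by rewrite WG.
by rewrite WV => -[Vx]; rewrite UO.
Qed.

Section Transfer.
Variables (X Y : topologicalType) (h : X -> Y) (g : Y -> X).
Hypothesis gK : cancel g h.
Variables (A B O1 : set Y) (O2 : set X).
Let V := B `&` O1.
Let C := closure (g @` V).

Hypothesis g_cont : forall T, open T ->
  exists2 G : set Y, open G & B `&` O1 `&` g @^-1` T = B `&` G.
Hypothesis h_cont : forall T, open T ->
  exists2 G : set X, open G & C `&` O2 `&` h @^-1` T = C `&` G.

(** Continuity on [C `&` O2] makes the preimage of the closed set [A] closed
    there, and it contains a dense subset. *)
Lemma closure_image_sub : closed A -> B `<=` A ->
  C `&` O2 `<=` h @^-1` A.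
Proof.
move=> cA BA x [Cx Ox]; apply: contrapT => nAx.
have [G oG GE] := h_cont (closed_openC cA).
have [_ Gx] : (C `&` G) x by rewrite -GE.
have [z [[y Vy <-] Gy]] := Cx _ (open_nbhs_nbhs (conj oG Gx)).
have : (C `&` G) (g y).
  by split => //; apply: subset_closure; exists y.
rewrite -GE => -[_]; rewrite /= gK; apply.
by case: Vy => /BA.
Qed.

(** Here [W `&` O1] is the open set that cuts [V] out of [A].  Openness of [D]
    is continuity of [h], together with [closure_image_sub] to leave out the
    condition of lying in [A].  For density, a nonempty open part of [C] meets
    [g @` V] inside [O2]; continuity of [g] on [V] turns this intersection into
    a nonempty open part of [A], which [U] must meet. *)
Lemma pullback_open_dense (W : set Y) (U : set A) :
  open W -> open O1 -> open O2 -> closed A -> B = A `&` W ->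
  (forall T, open T -> C `&` T !=set0 -> C `&` T `&` O2 !=set0) ->
  open U -> dense U ->
  let D := [set c : C | O2 (val c) /\ (W `&` O1 `&` val @` U) (h (val c))] in
  open D /\ dense D.
Proof.
move=> oW oO1 oO2 cA BE dO2 oU dU D.
have [U0 oU0 UE] := (open_set_typeP U).1 oU.
have BA : B `<=` A by rewrite BE; exact: subIsetl.
split.
  have [G oG GE] := h_cont (openI (openI oW oO1) oU0).
  apply/open_set_typeP; exists G => //.
  rewrite eqEsubset; split=> c /=; have Cc := set_valP c.
    move=> [ O2c [WOc [a Ua ac]]].
    suff [] : (C `&` G) (val c) by [].
    rewrite -GE; split => //; split => //=.
    by rewrite -ac; rewrite UE in Ua.
  move=> Gc; have : (C `&` G) (val c) by [].
  rewrite -GE => -[CO [WO Uc]]; split; first by case: CO.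
  have Ac : A (h (val c)) := closure_image_sub cA BA CO.
  split => //; exists (SigSub (mem_set Ac)) => //.
  by rewrite UE.
move=> T' [c Tc] /open_set_typeP[T oT TE].
have [x [[Cx Tx] Ox]] : C `&` T `&` O2 !=set0.
  apply: dO2 => //; exists (val c); split; first exact: set_valP.
  by rewrite TE in Tc.
have oTO : open (T `&` O2) by exact: openI.
have [z [[y Vy <-] TOy]] := Cx _ (open_nbhs_nbhs (conj oTO (conj Tx Ox))).
have [H oH HE] := g_cont oTO.
have [By Hy] : (B `&` H) y by rewrite -HE.
(* [A `&` W `&` H] is nonempty and open in [A], and [g] maps it into [T]. *)
have [a [[Wa Ha] Ua]] : (val @^-1` (W `&` H) : set A) `&` U !=set0.
  apply: dU; last by apply/open_set_typeP; exists (W `&` H) => //; exact: openI.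
  exists (exist _ y (mem_set (BA _ By))); split => //.
  by have [] : (A `&` W) y by rewrite -BE.
have : (B `&` H) (val a).
  by split => //; rewrite BE; split => //; apply: set_valP.
rewrite -HE => -[[Ba O1a] [Ta O2a]].
have Ca : C (g (val a)) by apply: subset_closure; exists (val a).
exists (SigSub (mem_set Ca)); split; first by rewrite TE.
split => //=; rewrite gK; split => //.
by exists a.
Qed.

End Transfer.

Lemma hereditarily_baire_transfer (X Y : topologicalType)
    (h : X -> Y) (g : Y -> X) :
  cancel g h -> weakly_discontinuous h ->
  weakly_discontinuous g -> hereditarily_baire X -> hereditarily_baire Y.
Proof.
move=> gK wh wg bX A cA F cF F_od W' [w Ww] /open_set_typeP[W oW WE].
pose B := A `&` W.
have [ O1 [oO1 dO1 g_cont]] := weakly_discontinuous_ambient wg B.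
pose C := closure (g @` (B `&` O1)).
have [ O2 [oO2 dO2 h_cont]] := weakly_discontinuous_ambient wh C.
pose D (U : set A) :=
  [set c : C | O2 (val c) /\ (W `&` O1 `&` val @` U) (h (val c))].
have Dod U : open U -> dense U -> open (D U) /\ dense (D U).
  by move=> oU dU; apply: (@pullback_open_dense _ _ h g gK A B O1 O2).
have [y [[By _] O1y]] : B `&` setT `&` O1 !=set0.
  apply: dO1; first exact: openT.
  exists (val w); split => //; split; first exact: set_valP.
  by rewrite WE in Ww.
have Cy : C (g y) by apply: subset_closure; exists y.
have bC : baire_space C by apply: bX; exact: closed_closure.
have dT : dense [set: A] by move=> T [x Tx] _; exists x.
(* Density inside [D setT], rather than in all of [C], places the image of the
   common point in [W], also when [F] is empty. *)
have [oDT dDT] := Dod setT openT dT.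
have DT0 : D setT !=set0.
  have [|c [_ Dc]] := dDT setT _ openT; last by exists c.
  by exists (SigSub (mem_set Cy)).
have [||c [DTc cD]] := bC (D @` F) _ _ (D setT) DT0 oDT.
- exact: sub_countable (card_image_le _ _) cF.
- by move=> _ [U FU <-]; have [oU dU] := F_od _ FU; apply: Dod.
have [_ [[Wc _] [a _ ac]]] := DTc.
exists a; split; first by rewrite WE /= ac.
move=> U FU.
have [_ [_ [a' Ua' a'c]]] : D U c by apply: cD; exists U.
by rewrite (_ : a = a') //; apply: val_inj; rewrite ac a'c.
Qed.

Theorem theorem3p14 (X Y : topologicalType) (h : X -> Y) :
  weak_homeomorphism h -> (hereditarily_baire X <-> hereditarily_baire Y).
Proof.
move=> [g [hK gK wh wg]]; split.
  exact: hereditarily_baire_transfer gK wh wg.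
exact: hereditarily_baire_transfer hK wg wh.
Qed.
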